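(* Let $\mathscr{H}_1,\mathscr{H}_2$ be complex Hilbert spaces and let $T:\mathscr{H}_1\to\mathscr{H}_2$ be a densely defined linear operator (not assumed closable) with characteristic projection $E=E_T=\begin{bmatrix}E_{11}&E_{12}\\ E_{21}&E_{22}\end{bmatrix}$. Then $T$ has a maximal closable part $T_{clo}$: for every $x\in dom(T)$ the limit $$T_{clo}\,x:=\lim_{n\to\infty}\frac{1}{n+1}\sum_{k=1}^{n}k\,E_{22}^{\,n-k}E_{21}x$$ exists, and the operator $T_{clo}:\mathscr{H}_1\to\mathscr{H}_2$ so defined on the domain $dom(T_{clo}):=dom(T)$ is closable. Moreover, if $Q$ is the orthogonal projection of $\mathscr{H}_2$ onto $\overline{(I-E_{22})\mathscr{H}_2}=\ker(I-E_{22})^{\perp}$, then the characteristic projection of $T_{clo}$ is $$E_{T_{clo}}=\begin{bmatrix}E_{11}&E_{12}Q\\ QE_{21}&E_{22}Q\end{bmatrix}.$$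
   Context: For a densely defined linear operator $T$ from $\mathscr{H}_1$ to $\mathscr{H}_2$, its graph is $G_T=\left\{\begin{bmatrix}\varphi\\ T\varphi\end{bmatrix}\mid\varphi\in dom(T)\right\}\subset\mathscr{H}_1\oplus\mathscr{H}_2$. The characteristic projection $E_T$ of $T$ is the orthogonal projection in $\mathscr{H}_1\oplus\mathscr{H}_2$ onto the closure $\overline{G_T}$, written as a block matrix with bounded entries $E_{ij}:\mathscr{H}_j\to\mathscr{H}_i$, $i,j=1,2$. $T$ is closable if $\overline{G_T}$ is the graph of an operator. *)

(* Defs.v *)
From HB Require Import structures.
From mathcomp Require Import all_boot all_order all_algebra.
From mathcomp Require Import all_classical all_reals all_analysis.
From mathcomp Require Import complex.

Set Implicit Arguments.
Unset Strict Implicit.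
Unset Printing Implicit Defensive.

Import Order.TTheory GRing.Theory Num.Theory.
Import numFieldNormedType.Exports.

Local Open Scope classical_set_scope.
Local Open Scope ring_scope.
Local Open Scope complex_scope.

(* Complex Hilbert spaces.  The norm of a normed module over [R[i]] takes its
   values in [R[i]] (in fact in the nonnegative reals); [hdot] is linear in its
   first argument and conjugate-linear in its second. *)
HB.mixin Record CompleteNormedModule_isHilbert (R : realType) H
    of CompleteNormedModule R[i] H := {
  hdot : {dot H for @Num.conj R[i]};
  hdot_norm : forall x : H, `|x| ^+ 2 = hdot x x
}.

#[short(type="hilbertType")]
HB.structure Definition Hilbert (R : realType) :=
  {H of CompleteNormedModule R[i] H & CompleteNormedModule_isHilbert R H}.

(* [H1 * H2] is given the direct-sum inner product.  The library norm on a
   product is the max norm; it is equivalent to the Hilbert norm of the direct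
   sum, so that [closure] in [H1 * H2] is the closure in the direct sum. *)
Definition dsum_dot (R : realType) (H1 H2 : hilbertType R) (u v : H1 * H2)
  : R[i] := hdot u.1 v.1 + hdot u.2 v.2.

Definition orthocomp (R : realType) (V : Type) (f : V -> V -> R[i])
  (M : set V) : set V := [set v | forall m, M m -> f v m = 0].

(* [P] is the orthogonal projection onto [M] for the inner product [f].
   This determines [P], and forces [M] to be a closed subspace and [P] to be
   linear and bounded. *)
Definition is_orthproj (R : realType) (V : zmodType) (f : V -> V -> R[i])
  (M : set V) (P : V -> V) : Prop :=
  forall v, M (P v) /\ orthocomp f M (v - P v).

(* Linear operators from [H1] to [H2], not necessarily everywhere defined;
   the values of [opfun] outside [dom] are irrelevant. *)
Record operator (R : realType) (H1 H2 : hilbertType R) := Operator {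
  dom : set H1;
  opfun :> H1 -> H2;
  dom0 : dom 0;
  domP : forall (a : R[i]) (x y : H1), dom x -> dom y -> dom (a *: x + y);
  opfunP : forall (a : R[i]) (x y : H1), dom x -> dom y ->
    opfun (a *: x + y) = a *: opfun x + opfun y
}.

Section Operators.
Context (R : realType) (H1 H2 : hilbertType R).
Implicit Types (S T : operator H1 H2) (E : H1 * H2 -> H1 * H2).

Definition graph T : set (H1 * H2) := [set (x, T x) | x in dom T].

Definition densely_defined T : Prop := dense (dom T).

Definition closable T : Prop :=
  exists S : operator H1 H2, closure (graph T) = graph S.

Definition is_char_proj T E : Prop :=
  is_orthproj (@dsum_dot R H1 H2) (closure (graph T)) E.

Definition E11 E (x : H1) : H1 := (E (x, 0)).1.
Definition E12 E (y : H2) : H1 := (E (0, y)).1.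
Definition E21 E (x : H1) : H2 := (E (x, 0)).2.
Definition E22 E (y : H2) : H2 := (E (0, y)).2.

Definition block_op (A11 : H1 -> H1) (A12 : H2 -> H1)
    (A21 : H1 -> H2) (A22 : H2 -> H2) : H1 * H2 -> H1 * H2 :=
  fun v => (A11 v.1 + A12 v.2, A21 v.1 + A22 v.2).

(* A part of [T] is a compression [P T], on the domain of [T], by an orthogonal
   projection [P] of [H2]. *)
Definition part_of S T : Prop :=
  dom S = dom T /\
  exists (M : set H2) (P : H2 -> H2),
    is_orthproj hdot M P /\ (forall x, dom T x -> S x = P (T x)).

(* Maximal for the order [part_of]: every closable part of [T] is a part of
   [S]. *)
Definition maximal_closable_part S T : Prop :=
  [/\ closable S, part_of S T &
      forall S', closable S' -> part_of S' T -> part_of S' S].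

Definition cesaro_clo E (x : H1) : nat -> H2 := fun n =>
  (n.+1%:R : R[i])^-1 *:
    \sum_(1 <= k < n.+1) (k%:R : R[i]) *: iter (n - k) (E22 E) (E21 E x).

End Operators.

(* Main.v *)
From HB Require Import structures.
Require Import Defs.
From mathcomp Require Import all_boot all_order all_algebra.
From mathcomp Require Import all_classical all_reals all_analysis.
From mathcomp Require Import complex.

(** Write [G] for the closure of the graph of [T], [A] for [E22 E] and [N] for
    the kernel of [I - A].  Compressing the projection [E] to [H2] shows that
    [A] is symmetric with [A ^ 2 <= A], that is [0 <= A <= I]; and [N] is the
    set of the [y] with [(0, y)] in [G] ([ker_E22P]), so [N] is exactly what
    prevents [G] from being a graph.

    For [x] in the domain of [T], [E] fixes [(x, T x)], whence
    [E21 x = T x - A (T x)] ([E21_dom]).  Summation by parts then turns the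
    averages of the statement into [y - (1 / (n + 1)) \sum_(j <= n) A ^ j y]
    with [y = T x] ([weighted_sum_iterE]).  This is the mean ergodic theorem
    for [A], made easy by positivity: [||A ^ n y||] is nonincreasing and
    [||A ^ n y - A ^ m y|| ^ 2 <= ||A ^ n y|| ^ 2 - ||A ^ m y|| ^ 2] for
    [n <= m], so that [A ^ n y] itself converges ([iter_cvg]), to a fixed
    point, while [y - A ^ n y] is always in the range of [I - A].  Hence the
    limit of [A ^ n] is the orthogonal projection onto [N], its complement [Q]
    is the projection onto the closed range of [I - A]
    ([limit_iter_orthproj], [ran_orthproj], [closure_ranE]), and the limit
    sought is [Q (T x)].  Obtaining the two projections as limits provides
    their existence without an appeal to the projection theorem.

    It remains to study [Q T].  Since [0 (+) N] lies in [G], the operator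
    [1 (+) Q] maps [G] into itself, and the closure of the graph of [Q T] is
    the set of the [u] in [G] whose second component is orthogonal to [N]
    ([closure_clo_part]).  It meets [0 (+) H2] only at [0], so [Q T] is closable
    ([vertical_closable]).  The operators [E] and [1 (+) Q] commute, so their
    product is the projection onto that intersection, and its blocks are those
    of the statement ([clo_part_char_proj]).  Finally, if a compression [P T] is
    closable, applying [1 (+) P] to the points [(0, n)] of [G] shows that [P]
    vanishes on [N]; so [P T = P (Q T)] is a part of [Q T]
    ([clo_part_maximal]). *)

Set Implicit Arguments.
Unset Strict Implicit.
Unset Printing Implicit Defensive.

Import Order.TTheory GRing.Theory Num.Theory.
Import numFieldNormedType.Exports.

Local Open Scope classical_set_scope.
Local Open Scope ring_scope.

(** * Inner products and orthogonal projections *)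

Section DotForm.
Context {R : realType} {U : lmodType R[i]} (f : {dot U for @Num.conj R[i]}).
Implicit Types u v : U.

Lemma dot_conj u v : f u v = (f v u)^*.
Proof. by rewrite [LHS]hermitian_subproof expr0 mul1r. Qed.

Lemma dot_eq0C u v : f u v = 0 -> f v u = 0.
Proof. by rewrite [f v u]dot_conj => ->; rewrite conjC0. Qed.

Lemma cauchy_schwarz u v : `|f u v| ^+ 2 <= f u u * f v v.
Proof.
have [->|v0] := eqVneq v 0; first by rewrite !linear0r normr0 expr0n.
have fv : 0 < f v v by rewrite dnorm_gt0.
(* Pythagoras for the components of [u] along [v] and orthogonal to [v] *)
pose c := f u v / f v v; pose w := u - c *: v.
have wv : f w v = 0.
  by rewrite linearBl linearZl_LR /= divfK ?subrr ?gt_eqF.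
have -> : u = w + c *: v by rewrite subrK.
rewrite hnormDd; last by rewrite linearZr_LR /= wv mulr0.
rewrite linearDl /= wv add0r linearZl_LR dnormZ normrM exprMn.
rewrite (ger0_norm (ltW fv)) mulrDl -(mulrA (`|c| ^+ 2)) -expr2 lerDr.
by rewrite mulr_ge0 ?dnorm_ge0.
Qed.

Section OrthogonalProjection.
Variables (M : set U) (P : U -> U).
Hypothesis MP : is_orthproj f M P.

Lemma orthproj_id m : M m -> P m = m.
Proof.
move=> Mm; have [MPm ort] := MP m.
by apply/esym/eqP; rewrite -subr_eq0 -(dnorm_eq0 f) linearBr /= !ort ?subr0.
Qed.

Lemma orthproj_idem v : P (P v) = P v.
Proof. exact/orthproj_id/(MP v).1. Qed.

Lemma orthproj_dotl u v : f (P u) (P v) = f u (P v).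
Proof.
apply/esym/eqP; rewrite -subr_eq0; apply/eqP.
by rewrite -[LHS](linearBl f (P v)); apply: (MP u).2; exact: (MP v).1.
Qed.

Lemma orthproj_sym u v : f (P u) v = f u (P v).
Proof. by rewrite -orthproj_dotl dot_conj -orthproj_dotl -dot_conj. Qed.

Lemma orthproj_uniq u v : M v -> orthocomp f M (u - v) -> P u = v.
Proof.
move=> Mv ort; apply/eqP; rewrite -subr_eq0 -(dnorm_eq0 f).
have [MPu ortP] := MP u.
have dm m : M m -> f (P u - v) m = 0.
  move=> Mm; have -> : P u - v = (u - v) - (u - P u).
    by rewrite opprB [RHS]addrC subrKA.
  by rewrite linearBl /= ort// ortP// subrr.
by rewrite linearBr /= !dm// subrr.
Qed.

(** The defect [d] of linearity is a combination of values of [P], and is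
    orthogonal to all of them by symmetry of [P]; hence it is orthogonal to
    itself. *)
Lemma orthproj_linear : linear P.
Proof.
move=> a u v; apply/eqP; rewrite -subr_eq0 -(dnorm_eq0 f).
set d := _ - _.
suff dm m : f d (P m) = 0.
  by rewrite {2}/d linearBr linearDr /= linearZr_LR /= !dm mulr0 !addr0 subr0.
rewrite /d linearBl linearDl linearZl_LR /= !orthproj_dotl.
by rewrite linearDl linearZl_LR subrr.
Qed.

Lemma orthproj_dot_le v : f (P v) (P v) <= f v v.
Proof.
have -> : f v v = f (P v) (P v) + f (v - P v) (v - P v).
  rewrite -hnormDd; first by rewrite addrC subrK.
  by apply: dot_eq0C; apply: (MP v).2; exact: (MP v).1.
by rewrite lerDl dnorm_ge0.
Qed.

End OrthogonalProjection.
End DotForm.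

(** The direct-sum form is registered as an inner product so that the lemmas
    above apply to characteristic projections as well as to projections of
    [H2]. *)
Section DirectSum.
Context {R : realType} {H1 H2 : hilbertType R}.

Fact dsum_dot_bilinear :
  bilinear_for (GRing.Scale.Law.clone _ _ *%R _)
    (GRing.Scale.Law.clone _ _ (@Num.conj R[i] \; *%R) _)
    (@dsum_dot R H1 H2).
Proof.
split=> [w|w] a u v; rewrite /dsum_dot /=.
  by rewrite !linearPl mulrDr addrACA.
by rewrite !linearPr /= mulrDr addrACA.
Qed.

HB.instance Definition _ := bilinear_isBilinear.Build R[i]
  (H1 * H2)%type (H1 * H2)%type R[i] _ _ (@dsum_dot R H1 H2) dsum_dot_bilinear.

Fact dsum_dot_hermitian (u v : H1 * H2) :
  dsum_dot u v = (-1) ^+ false * (dsum_dot v u)^*.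
Proof. by rewrite expr0 mul1r /dsum_dot rmorphD /= -!dot_conj. Qed.

HB.instance Definition _ := isHermitianSesquilinear.Build R[i]
  (H1 * H2)%type false Num.conj (@dsum_dot R H1 H2) dsum_dot_hermitian.

Fact dsum_dot_gt0 (u : H1 * H2) : u != 0 -> 0 < dsum_dot u u.
Proof.
rewrite /dsum_dot lt0r addr_ge0 ?dnorm_ge0// andbT; apply: contra.
rewrite paddr_eq0 ?dnorm_ge0// !dnorm_eq0.
by case: u => x y /= /andP[/eqP-> /eqP->].
Qed.

HB.instance Definition _ := isDotProduct.Build R[i]
  (H1 * H2)%type (@dsum_dot R H1 H2) dsum_dot_gt0.

Lemma dsum_dot_sndr (u : H1 * H2) y : dsum_dot u (0, y) = hdot u.2 y.
Proof. by rewrite /dsum_dot /= linear0r add0r. Qed.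

Lemma dsum_dot_sndl (u : H1 * H2) y : dsum_dot (0, y) u = hdot y u.2.
Proof. by rewrite /dsum_dot /= linear0l add0r. Qed.

End DirectSum.

(** * Closures and continuity *)

Section Topology.

Lemma closure_continuous {S T : topologicalType} (g : S -> T) (A : set S)
    (B : set T) (v : S) :
  {for v, continuous g} -> (forall a, A a -> B (g a)) ->
  closure A v -> closure B (g v).
Proof.
move=> gv AB Av V /gv Vg; have [a [Aa Va]] := Av _ Vg.
by exists (g a); split; [exact: AB|].
Qed.

Lemma closureP_norm {K : numFieldType} {V : normedModType K} (A : set V) v :
  closure A v <-> forall e : K, 0 < e -> exists2 w, A w & `|v - w| < e.
Proof.
split=> [Av e e0|Av B].
  have [w [Aw vw]] := Av _ (nbhsx_ballx v e e0).
  by exists w => //; move: vw; rewrite -ball_normE.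
rewrite -nbhs_ballE => -[e /= e0 eB]; have [w Aw vw] := Av e e0.
by exists w; split=> //; apply: eB; rewrite -ball_normE.
Qed.

Lemma nonexpansive_continuous {K : numFieldType} {V W : normedModType K}
    (g : V -> W) : (forall u v, `|g u - g v| <= `|u - v|) -> continuous g.
Proof.
move=> gle u; apply/cvgrPdist_lt => e e0.
apply: filterS (nbhsx_ballx u e e0) => v.
by rewrite -ball_normE; apply: le_lt_trans.
Qed.

End Topology.

Section HilbertTopology.
Context {R : realType} {H : hilbertType R}.
Implicit Types (x y : H) (M : set H).

Lemma ler_norm_dot x y : (`|x| <= `|y|) = (hdot x x <= hdot y y).
Proof. by rewrite -!hdot_norm ler_pXn2r ?nnegrE. Qed.

Lemma orthocomp_closed M : closed (orthocomp hdot M).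
Proof.
move=> v /closureP_norm clv m Mm; apply/eqP; rewrite -normr_le0.
apply/ler_addgt0Pr => e e0; rewrite add0r.
(* [+ 1] keeps the denominator positive when [m] is zero *)
have m1 : 0 < `|m| + 1 by rewrite ltr_wpDl.
have [w ortw vw] := clv (e / (`|m| + 1)) (divr_gt0 e0 m1).
have -> : hdot v m = hdot (v - w) m by rewrite linearBl /= ortw ?subr0.
have cs : `|hdot (v - w) m| <= `|v - w| * `|m|.
  rewrite -(@ler_pXn2r _ 2) ?nnegrE ?mulr_ge0// exprMn !hdot_norm.
  exact: cauchy_schwarz.
apply: le_trans cs _.
rewrite -[leRHS](@divfK _ (`|m| + 1)) ?gt_eqF//.
by apply: ler_pM => //; [exact: ltW|rewrite lerDl].
Qed.

Lemma orthproj_continuous M P : is_orthproj hdot M P -> continuous P.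
Proof.
move=> MP; have PB := zmod_morphism_linear (orthproj_linear MP).
apply: nonexpansive_continuous => u v.
by rewrite -PB ler_norm_dot; exact: (orthproj_dot_le MP).
Qed.

End HilbertTopology.

(** * Convergence with complex-valued norms *)

(** Norms and squared norms are nonnegative elements of [R[i]], hence real:
    [complex.Re] carries them to [R], where monotone convergence and the lemma
    of Cesaro apply. *)
Section ComplexSequences.
Context {R : realType}.

Lemma Re_ge0K (z : R[i]) : 0 <= z -> (complex.Re z)%:C%C = z.
Proof. by move=> z0; apply/RRe_real/ger0_real. Qed.

Lemma nonincreasing_cauchy (r : nat -> R[i]) :
  (forall n, 0 <= r n) -> (forall n, r n.+1 <= r n) ->
  forall e, 0 < e -> exists N, forall n, (N <= n)%N -> r N - r n < e.
Proof.
move=> r0 rS e e0.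
have rE n : r n = (complex.Re (r n))%:C%C by rewrite Re_ge0K.
have eE : e = (complex.Re e)%:C%C by rewrite Re_ge0K ?ltW.
pose u n := complex.Re (r n).
have lbu : has_lbound (range u).
  by exists 0 => _ [n _ <-]; rewrite -(lecR 0) -rE.
have infu : has_inf (range u) by split; [exists (u 0%N), 0%N|].
have Re0 : 0 < complex.Re e by rewrite -(ltcR 0) -eE.
have [_ [N _ <-] uN] := inf_adherent Re0 infu.
exists N => n Nn; rewrite rE [r n]rE eE -rmorphB ltcR ltrBlDr.
apply: lt_le_trans uN _; rewrite addrC lerD2l.
by apply: ge_inf lbu _ _; exists n.
Qed.

Lemma cesaro_normed {V : normedModType R[i]} (u : nat -> V) (p : V) :
  u n @[n --> \oo] --> p ->
  (n.+1%:R : R[i])^-1 *: \sum_(0 <= j < n.+1) u j @[n --> \oo] --> p.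
Proof.
move=> up; pose d n := complex.Re `|p - u n|.
have d0 : d n @[n --> \oo] --> 0.
  apply/cvgr0Pnorm_lt => e e0; near=> n.
  have dn : 0 <= d n by rewrite -(lecR 0) Re_ge0K; exact: normr_ge0.
  rewrite ger0_norm// -ltcR Re_ge0K//; near: n.
  by move/cvgrPdist_lt: up; apply; rewrite (ltcR 0).
move/cesaro/cvgr0Pnorm_lt: d0 => md0.
apply/cvgrPdist_lt => e e0.
have eE : e = (complex.Re e)%:C%C by rewrite Re_ge0K ?ltW.
have Re0 : 0 < complex.Re e by rewrite -(ltcR 0) -eE.
near=> n.
have n1 : (n.+1%:R : R[i]) != 0 by rewrite pnatr_eq0.
have -> : p - (n.+1%:R : R[i])^-1 *: \sum_(0 <= j < n.+1) u j =
    (n.+1%:R : R[i])^-1 *: \sum_(0 <= j < n.+1) (p - u j).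
  rewrite sumrB scalerBr sumr_const_nat subn0 -(scaler_nat _ p).
  by rewrite scalerA mulVf// scale1r.
rewrite normrZ normfV normr_nat.
apply: (@le_lt_trans _ _ (arithmetic_mean d n)%:C%C).
  rewrite /arithmetic_mean /= rmorphM fmorphV rmorph_nat /series /= rmorph_sum.
  rewrite ler_pM2l ?invr_gt0 ?ltr0n//.
  rewrite (eq_bigr _ (fun j _ => Re_ge0K (normr_ge0 (p - u j)))).
  exact: ler_norm_sum.
rewrite eE ltcR; apply: le_lt_trans (ler_norm _) _.
by near: n; exact: md0.
Unshelve. all: by end_near. Qed.

End ComplexSequences.

(** * Iterates of a positive contraction *)

(** The hypothesis [A_firm], which says that [A ^ 2 <= A], encodes
    [0 <= A <= I] for a symmetric [A], and is the form in which it comes out of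
    the compression of a projection. *)
Section Iterates.
Context {R : realType} {H : hilbertType R} (A : {linear H -> H}).
Hypothesis A_sym : forall x y, hdot (A x) y = hdot x (A y).
Hypothesis A_firm : forall x, hdot (A x) (A x) <= hdot (A x) x.
Implicit Types x y z : H.

(** [A <= I] because [I - A = (I - A) ^ 2 + (A - A ^ 2)]. *)
Lemma firm_dot_le x : hdot (A x) x <= hdot x x.
Proof.
rewrite -subr_ge0; apply: le_trans (dnorm_ge0 hdot (x - A x)) _.
rewrite dnormB -dot_conj -(A_sym x x) opprD addrACA gerDl subr_le0.
exact: A_firm.
Qed.

Lemma firm_norm_le x : `|A x| <= `|x|.
Proof. by rewrite ler_norm_dot (le_trans (A_firm x)) ?firm_dot_le. Qed.

Lemma firm_continuous : continuous A.
Proof.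
by apply: nonexpansive_continuous => x y; rewrite -linearB firm_norm_le.
Qed.

Lemma iter_dot_sym n x y : hdot (iter n A x) y = hdot x (iter n A y).
Proof. by elim: n y => //= n IHn y; rewrite A_sym IHn -iterSr. Qed.

(** With [w = A ^ m x], the case [n = 2 m] is [A <= I] at [w] and the case
    [n = 2 m + 1] is [A ^ 2 <= A] at [w]. *)
Lemma iter_dot_noninc n x : hdot (iter n.+1 A x) x <= hdot (iter n A x) x.
Proof.
rewrite -(odd_double_half n) -addnn; set m := n./2.
have split_iter i : hdot (iter (i + (m + m)) A x) x =
    hdot (iter i A (iter m A x)) (iter m A x).
  by rewrite addnA addnC iterD iter_dot_sym iterD.
rewrite -addSn !split_iter; case: (odd n) => /=; last exact: firm_dot_le.
by rewrite A_sym; exact: A_firm.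
Qed.

Lemma iter_firm n x : hdot (iter n A x) (iter n A x) <= hdot (iter n A x) x.
Proof.
suff le_iter m : hdot (iter (m + n) A x) x <= hdot (iter n A x) x.
  by rewrite -iter_dot_sym -iterD.
by elim: m => // m; apply: le_trans; rewrite addSn iter_dot_noninc.
Qed.

(** The estimate behind convergence: expanding the left-hand side, the cross
    terms dominate twice the squared norm of [iter n A x] by [iter_firm]. *)
Lemma iter_dist_le n x :
  hdot (x - iter n A x) (x - iter n A x) <=
  hdot x x - hdot (iter n A x) (iter n A x).
Proof.
have le_n := iter_firm n x.
rewrite dnormB -dot_conj -(iter_dot_sym n x x) -addrA lerD2l.
by rewrite lerBlDr addrC lerBrDr; exact: lerD.
Qed.

Lemma iter_cvg x : cvg (iter n A x @[n --> \oo]).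
Proof.
apply/cauchy_cvgP/cauchy_exP => e e0.
pose r n := hdot (iter n A x) (iter n A x).
have [||N rN] := @nonincreasing_cauchy R r _ _ (e ^+ 2) (exprn_gt0 2 e0).
- by move=> n; exact: dnorm_ge0.
- by move=> n; rewrite /r -ler_norm_dot firm_norm_le.
exists (iter N A x); exists N => // n /= Nn.
rewrite -ball_normE /= -(@ltr_pXn2r _ 2) ?nnegrE ?(ltW e0)//.
rewrite hdot_norm; apply: le_lt_trans (rN _ Nn).
by rewrite -(subnK Nn) /r iterD; exact: iter_dist_le.
Qed.

Let ker : set H := [set y | y - A y = 0].
Let ran : set H := range (fun y => y - A y).
Let limit_iter x : H := limn (fun n => iter n A x).

Lemma limit_iter_ker x : ker (limit_iter x).
Proof.
rewrite /ker /=; apply/eqP; rewrite subr_eq0; apply/eqP.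
have lim1 : iter n.+1 A x @[n --> \oo] --> limit_iter x.
  by rewrite (cvg_shiftS (fun n => iter n A x)); exact: iter_cvg.
have lim2 : iter n.+1 A x @[n --> \oo] --> A (limit_iter x).
  by apply: continuous_cvg; [exact: firm_continuous|exact: iter_cvg].
exact: cvg_unique lim1 lim2.
Qed.

Lemma limit_iter_ran x : closure ran (x - limit_iter x).
Proof.
(* [x - A ^ n x] is the image by [I - A] of [\sum_(j < n) A ^ j x] *)
have ran_iter n : ran (x - iter n A x).
  elim: n => [|n [z _ zx]]; first by exists 0; rewrite // linear0 !subrr.
  exists (z + iter n A x) => //.
  by rewrite linearD opprD addrACA zx subrKA.
apply: (@closed_cvg _ _ \oo _ (fun n => x - iter n A x) (closure ran)).
- exact: closed_closure.
- by apply: nearW => n; apply: subset_closure.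
- by apply: cvgB; [exact: cvg_cst|exact: iter_cvg].
Qed.

Lemma ran_orthocomp_ker : closure ran `<=` orthocomp hdot ker.
Proof.
rewrite [X in _ `<=` X](proj1 (closure_id _) (@orthocomp_closed _ _ _)).
apply: closureS => _ [x _ <-] y /subr0_eq yA.
by rewrite linearBl /= A_sym -yA subrr.
Qed.

Lemma limit_iter_orthproj : is_orthproj hdot ker limit_iter.
Proof.
move=> x; split; first exact: limit_iter_ker.
exact/ran_orthocomp_ker/limit_iter_ran.
Qed.

Lemma ran_orthproj :
  is_orthproj hdot (closure ran) (fun x => x - limit_iter x).
Proof.
move=> x; split; first exact: limit_iter_ran.
move=> y /ran_orthocomp_ker ort; rewrite opprB addrC subrK.
exact/dot_eq0C/ort/limit_iter_ker.
Qed.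

Lemma closure_ranE : closure ran = orthocomp hdot ker.
Proof.
apply/seteqP; split=> [|x ort]; first exact: ran_orthocomp_ker.
have limx0 : limit_iter x = 0.
  apply/eqP; rewrite -(dnorm_eq0 hdot) (orthproj_dotl limit_iter_orthproj).
  by rewrite ort//; exact: limit_iter_ker.
by have := @limit_iter_ran x; rewrite limx0 subr0.
Qed.

(** Summation by parts, in the form of the recurrence
    [S_(n+1) = A S_n + (n + 1) (x - A x)] for the left-hand side. *)
Lemma weighted_sum_iterE x n :
  \sum_(1 <= k < n.+1) (k%:R : R[i]) *: iter (n - k) A (x - A x) =
  n.+1%:R *: x - \sum_(0 <= j < n.+1) iter j A x.
Proof.
elim: n => [|n IHn]; first by rewrite big_geq// big_nat1 scale1r subrr.
have -> : \sum_(1 <= k < n.+2) (k%:R : R[i]) *: iter (n.+1 - k) A (x - A x) =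
    A (\sum_(1 <= k < n.+1) (k%:R : R[i]) *: iter (n - k) A (x - A x))
    + n.+1%:R *: (x - A x).
  rewrite big_nat_recr//= subnn linear_sum; congr (_ + _).
  by apply: eq_big_nat => k /andP[_ kn]; rewrite linearZ /= subSn.
have -> : \sum_(0 <= j < n.+2) iter j A x =
    x + A (\sum_(0 <= j < n.+1) iter j A x).
  by rewrite big_nat_recl//= linear_sum.
rewrite IHn linearB linearZ scalerBr [LHS]addrC /= subrKA opprD addrA.
by rewrite -[n.+2]addn1 natrD scalerDl scale1r addrK.
Qed.

Section RangeProjection.
Variable Q : H -> H.
Hypothesis ranQ : is_orthproj hdot (closure ran) Q.

Lemma ranprojE x : Q x = x - limit_iter x.
Proof.
by have [ranx ortx] := @ran_orthproj x; exact: (orthproj_uniq ranQ).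
Qed.

Lemma ranproj_ker x : ker (x - Q x).
Proof. by rewrite ranprojE subKr; exact: limit_iter_ker. Qed.

Lemma ranproj_id x : orthocomp hdot ker x -> Q x = x.
Proof. by rewrite -closure_ranE; exact: (orthproj_id ranQ). Qed.

Lemma ranproj_orthocomp x : orthocomp hdot ker (Q x).
Proof. by rewrite -closure_ranE; exact: (ranQ x).1. Qed.

Lemma weighted_mean_iter_cvg x :
  (n.+1%:R : R[i])^-1 *:
    \sum_(1 <= k < n.+1) (k%:R : R[i]) *: iter (n - k) A (x - A x)
  @[n --> \oo] --> Q x.
Proof.
rewrite ranprojE.
under eq_cvg => n do
  rewrite weighted_sum_iterE scalerBr scalerA mulVf ?pnatr_eq0// scale1r.
by apply: cvgB; [exact: cvg_cst|exact/cesaro_normed/iter_cvg].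
Qed.

End RangeProjection.
End Iterates.

(** * Closable operators and compressions *)

Section ClosableOperators.
Context {R : realType} {H1 H2 : hilbertType R}.
Implicit Types S T : operator H1 H2.

Lemma opfun0 T : T 0 = 0.
Proof.
have := opfunP (-1) (dom0 T) (dom0 T).
by rewrite scaler0 addr0 scaleN1r addNr.
Qed.

Lemma closable_vertical T y : closable T -> closure (graph T) (0, y) -> y = 0.
Proof. by move=> [S ->] [x _ [-> <-]]; exact: opfun0. Qed.

(** The characteristic projection serves only to see that the closure of the
    graph, being the set of its fixed points, is a linear subspace. *)
Lemma vertical_closable T E : is_char_proj T E ->
  (forall y, closure (graph T) (0, y) -> y = 0) -> closable T.
Proof.
move=> TE vert; have Elin := orthproj_linear TE.
set G := closure (graph T) in vert *.
have Glin a u v : G u -> G v -> G (a *: u + v).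
  move=> Gu Gv; rewrite -(orthproj_id TE Gu) -(orthproj_id TE Gv).
  by rewrite -Elin; exact: (TE _).1.
have G0 : G (0, 0).
  by apply: subset_closure; exists 0; [exact: dom0|rewrite opfun0].
have Gfun x y y' : G (x, y) -> G (x, y') -> y = y'.
  move=> Gy Gy'; apply/eqP; rewrite -subr_eq0 -oppr_eq0 opprB; apply/eqP/vert.
  have := Glin (-1) _ _ Gy Gy'.
  by rewrite scaleN1r /= -[_ + _]/(- x + x, - y + y') addNr addrC.
pose D : set H1 := [set x | exists y, G (x, y)].
have /choice[g gP] (x : H1) : exists y, D x -> G (x, y).
  have [[y Gy]|nD] := pselect (D x); first by exists y.
  by exists 0.
have D0 : D 0 by exists 0.
have Dlin a x y : D x -> D y -> D (a *: x + y).
  by move=> [x' Gx] [y' Gy]; exists (a *: x' + y'); exact: (Glin a _ _ Gx Gy).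
have glin a x y : D x -> D y -> g (a *: x + y) = a *: g x + g y.
  move=> Dx Dy; apply: (Gfun (a *: x + y)); first exact/gP/Dlin.
  exact: (Glin a _ _ (gP _ Dx) (gP _ Dy)).
exists (Operator D0 Dlin glin); apply/seteqP.
split=> [[x y] Gxy|_ [x Dx <-]]; last exact: gP.
have Dx : D x by exists y.
by exists x => //=; rewrite (Gfun _ _ _ Gxy (gP _ Dx)).
Qed.

Fact compression_linear T (P : H2 -> H2) (P_lin : linear P) a x y :
  dom T x -> dom T y -> P (T (a *: x + y)) = a *: P (T x) + P (T y).
Proof. by move=> Tx Ty; rewrite opfunP// P_lin. Qed.

Definition compression T (P : H2 -> H2) (P_lin : linear P) : operator H1 H2 :=
  @Operator R H1 H2 (dom T) (P \o T) (dom0 T) (@domP R H1 H2 T)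
    (compression_linear P_lin).

Lemma closure_graph_compress S T (M : set H2) (P : H2 -> H2) u :
  is_orthproj hdot M P ->
  (forall x, dom T x -> dom S x /\ S x = P (T x)) ->
  closure (graph T) u -> closure (graph S) (u.1, P u.2).
Proof.
move=> MP TS; pose g (w : H1 * H2) := (w.1, P w.2).
apply: (@closure_continuous _ _ g); last first.
  by move=> _ [x Tx <-]; have [Sx SE] := TS x Tx; exists x; rewrite // SE.
apply: cvg_pair => /=; first exact: cvg_fst.
apply: continuous_cvg; last exact: cvg_snd.
exact: (@orthproj_continuous _ _ M P MP u.2).
Qed.

End ClosableOperators.

(** * The maximal closable part *)

Section CharacteristicProjection.
Context {R : realType} {H1 H2 : hilbertType R} (T : operator H1 H2).
Context (E : H1 * H2 -> H1 * H2) (TE : is_char_proj T E).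
Let G : set (H1 * H2) := closure (graph T).

Let E_lin : linear E := orthproj_linear TE.

Let E_id u : G u -> E u = u := @orthproj_id _ _ _ _ _ TE u.

Let E_dotl u v : dsum_dot (E u) (E v) = dsum_dot u (E v) :=
  orthproj_dotl TE u v.

Let E_sym u v : dsum_dot (E u) v = dsum_dot u (E v) := orthproj_sym TE u v.

Lemma char_projD u v : E (u + v) = E u + E v.
Proof. by have := E_lin 1 u v; rewrite !scale1r. Qed.

Lemma E22_linear : linear (E22 E).
Proof.
move=> a x y; rewrite /E22 -[RHS]/((a *: E (0, x) + E (0, y)).2) -E_lin.
by rewrite -[a *: (0, x) + _]/(a *: 0 + 0, a *: x + y) scaler0 addr0.
Qed.

Let A : {linear H2 -> H2} :=
  HB.pack (E22 E) (GRing.isLinear.Build _ _ _ _ (E22 E) E22_linear).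

Lemma E22_sym x y : hdot (E22 E x) y = hdot x (E22 E y).
Proof. by rewrite -dsum_dot_sndr E_sym dsum_dot_sndl. Qed.

(** The right-hand side is the full squared norm of [E (0, x)], of which the
    left-hand side is the part in [H2]. *)
Lemma E22_firm x : hdot (E22 E x) (E22 E x) <= hdot (E22 E x) x.
Proof.
rewrite -(dsum_dot_sndr (E (0, x)) x) E_sym -E_dotl.
by rewrite /dsum_dot lerDr dnorm_ge0.
Qed.

Let ker : set H2 := [set y | y - E22 E y = 0].
Let ran : set H2 := range (fun y => y - E22 E y).

Lemma ker_E22P y : ker y <-> G (0, y).
Proof.
split=> [/subr0_eq yE|/E_id Ey]; last by rewrite /ker /= /E22 Ey subrr.
suff Ey : E (0, y) = (0, y) by rewrite -Ey; exact: (TE _).1.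
(* [E] does not increase norms, so there is no room for a first component *)
suff E1 : (E (0, y)).1 = 0.
  by rewrite [LHS]surjective_pairing E1 -/(E22 E y) -yE.
apply/eqP; rewrite -(dnorm_eq0 hdot).
have := E_dotl (0, y) (0, y).
rewrite dsum_dot_sndl /dsum_dot -/(E22 E y) -yE => /eqP.
by rewrite -subr_eq0 addrK.
Qed.

Lemma E21_dom x : dom T x -> E21 E x = T x - E22 E (T x).
Proof.
move=> Tx; have Ex : E (x, T x) = (x, T x).
  by apply/E_id/subset_closure; exists x.
have xE : (x, T x) = (x, 0) + (0, T x).
  by rewrite -[RHS]/(x + 0, 0 + T x) addr0 add0r.
move: Ex; rewrite {1}xE char_projD => /(congr1 snd) /= ETx.
by rewrite -[X in _ = X - _]ETx addrK.
Qed.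

Lemma range_E22_orthproj_exists : exists Q, is_orthproj hdot (closure ran) Q.
Proof. by eexists; exact: (ran_orthproj (A := A) E22_sym E22_firm). Qed.

Lemma closure_range_E22 : closure ran = orthocomp hdot ker.
Proof. exact: (closure_ranE (A := A) E22_sym E22_firm). Qed.

Section MaximalClosablePart.
Variable Q : H2 -> H2.
Hypothesis ranQ : is_orthproj hdot (closure ran) Q.

Let Q_ker y : ker (y - Q y) := ranproj_ker (A := A) E22_sym E22_firm ranQ y.

Let Q_id y : orthocomp hdot ker y -> Q y = y :=
  @ranproj_id _ _ A E22_sym E22_firm _ ranQ y.

Let Q_orthocomp y : orthocomp hdot ker (Q y) :=
  ranproj_orthocomp (A := A) E22_sym E22_firm ranQ y.

Definition clo_part : operator H1 H2 := compression T (orthproj_linear ranQ).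

Lemma cesaro_clo_cvg x : dom T x ->
  cesaro_clo E x n @[n --> \oo] --> clo_part x.
Proof.
move=> Tx; rewrite /cesaro_clo E21_dom//.
exact: (weighted_mean_iter_cvg (A := A) E22_sym E22_firm ranQ).
Qed.

Lemma closure_clo_part u :
  closure (graph clo_part) u <-> G u /\ orthocomp hdot ker u.2.
Proof.
split=> [clu|[Gu /Q_id Qu]]; last first.
  rewrite [u]surjective_pairing -Qu.
  by apply: (closure_graph_compress ranQ _ Gu) => x Tx; split.
split.
  (* [(x, Q (T x))] differs from [(x, T x)] by an element of [0 (+) ker] *)
  apply: (@closed_closure _ _ u); apply: closureS clu => _ [x Tx <-].
  have -> : (x, clo_part x) = (x, T x) - (0, T x - Q (T x)).
    by rewrite -[RHS]/(x - 0, T x - (T x - Q (T x))) subr0 subKr.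
  have := (TE ((x, T x) - (0, T x - Q (T x)))).1.
  rewrite (zmod_morphism_linear E_lin) E_id; last first.
    by apply: subset_closure; exists x.
  by rewrite E_id//; apply/ker_E22P/Q_ker.
apply: orthocomp_closed; apply: (@closure_continuous _ _ snd _ _ _ _ _ clu).
  exact: cvg_snd.
by move=> _ [x Tx <-]; exact: Q_orthocomp.
Qed.

(** [E] fixes [0 (+) ker] and is symmetric, so it preserves the orthogonal
    complement of [0 (+) ker]; this is the commutation of [E] with
    [1 (+) Q]. *)
Lemma char_proj_orthocomp u :
  orthocomp hdot ker u.2 -> orthocomp hdot ker (E u).2.
Proof.
move=> ort n kn; rewrite -dsum_dot_sndr E_sym E_id; last exact/ker_E22P.
by rewrite dsum_dot_sndr ort.
Qed.

(** The factor [Q] in front of [E21] is absorbed because the range of [E21] is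
    orthogonal to the kernel of [I - E22]. *)
Lemma block_opE u :
  block_op (E11 E) (E12 E \o Q) (Q \o E21 E) (E22 E \o Q) u = E (u.1, Q u.2).
Proof.
have -> : (u.1, Q u.2) = (u.1, 0) + (0, Q u.2).
  by rewrite -[RHS]/(u.1 + 0, 0 + Q u.2) addr0 add0r.
rewrite char_projD /block_op /= [Q (E21 E _)]Q_id//.
by apply: char_proj_orthocomp => n _ /=; rewrite linear0l.
Qed.

Lemma clo_part_char_proj : is_char_proj clo_part
  (block_op (E11 E) (E12 E \o Q) (Q \o E21 E) (E22 E \o Q)).
Proof.
move=> v; rewrite block_opE; have [GE ortE] := TE (v.1, Q v.2); split.
  apply/closure_clo_part; split=> //; apply: char_proj_orthocomp.
  exact: Q_orthocomp.
move=> m /closure_clo_part[Gm ortm].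
have -> : v - E (v.1, Q v.2) =
    (0, v.2 - Q v.2) + ((v.1, Q v.2) - E (v.1, Q v.2)).
  rewrite addrA; congr (_ - _).
  rewrite -[RHS]/(0 + v.1, v.2 - Q v.2 + Q v.2) add0r subrK.
  exact: surjective_pairing.
rewrite linearDl /= ortE// addr0 dsum_dot_sndl.
exact/dot_eq0C/ortm/Q_ker.
Qed.

Lemma clo_part_closable : closable clo_part.
Proof.
apply: vertical_closable clo_part_char_proj _ => y.
move=> /closure_clo_part[/ker_E22P ky ort].
by apply/eqP; rewrite -(dnorm_eq0 hdot) ort.
Qed.

Lemma clo_part_maximal : maximal_closable_part clo_part T.
Proof.
split; [exact: clo_part_closable| |].
  by split=> //; exists (closure ran), Q; split.
move=> S Sclo [domS [M [P [MP SP]]]]; split; first exact: domS.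
exists M, P; split=> // x Tx; rewrite SP//.
have kerP n : ker n -> P n = 0.
  move=> /ker_E22P Gn; apply: (closable_vertical Sclo).
  apply: (closure_graph_compress MP _ Gn) => y Ty.
  by rewrite domS SP.
apply/eqP; rewrite -subr_eq0.
by rewrite -(zmod_morphism_linear (orthproj_linear MP)) kerP.
Qed.

End MaximalClosablePart.
End CharacteristicProjection.

Theorem theorem3p11 (R : realType) (H1 H2 : hilbertType R)
    (T : operator H1 H2) (E : H1 * H2 -> H1 * H2) :
  densely_defined T ->
  is_char_proj T E ->
  exists Tclo : operator H1 H2,
    [/\ dom Tclo = dom T,
        (forall x, dom T x -> cesaro_clo E x n @[n --> \oo] --> Tclo x),
        maximal_closable_part Tclo T &
        closure (range (fun y => y - E22 E y)) =
          orthocomp hdot [set y | y - E22 E y = 0] /\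
        forall Q : H2 -> H2,
          is_orthproj hdot (closure (range (fun y => y - E22 E y))) Q ->
          is_char_proj Tclo
            (block_op (E11 E) (E12 E \o Q) (Q \o E21 E) (E22 E \o Q))].
Proof.
move=> _ TE; have [Q ranQ] := range_E22_orthproj_exists TE.
exists (clo_part T ranQ); split; first by [].
- by move=> x; exact: cesaro_clo_cvg.
- exact: clo_part_maximal.
split=> [|Q' ranQ']; first exact: closure_range_E22 TE.
suff -> : Q' = Q by exact: clo_part_char_proj.
by apply/funext => y; have [Qy orty] := ranQ y; exact: (orthproj_uniq ranQ').
Qed.
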